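(* The generating function $A(q)=\sum_{n\ge1}a(n)q^n$ admits the factorization $$A(q)=P(q)\,S(q),$$ where $$S(q)=\sum_{r=1}^\infty(-1)^{T_{r-1}}\,T_{\lceil r/2\rceil}\,q^{T_{r+1}}.$$
   Context: For a positive integer $n$, $a(n)$ is the signed number of partitions of $n$ into exactly two distinct part sizes, each occurring an odd number of times: $$a(n)=\sum (-1)^{r_1+r_2},$$ the sum being over all quadruples of integers $(x,y,r_1,r_2)$ with $1\le x<y$, $r_1,r_2\ge 0$ and $(2r_1+1)x+(2r_2+1)y=n$. Equivalently, $$A(q)=\sum_{n\ge1}a(n)q^n=\sum_{1\le n_1<n_2}\frac{q^{n_1}}{1+q^{2n_1}}\cdot\frac{q^{n_2}}{1+q^{2n_2}}.$$ For $|q|<1$, $(a;q)_\infty=\prod_{n=0}^\infty(1-aq^n)$. The series $P(q)$ is $$P(q)=\sum_{n\ge0}\mathrm{pod}(n)q^n=\frac{(-q;q^2)_\infty}{(q^2;q^2)_\infty}=\frac{(q^2;q^2)_\infty}{(q;q)_\infty(q^4;q^4)_\infty},$$ where $\mathrm{pod}(n)$ is the number of partitions of $n$ in which odd parts are distinct (even parts are unrestricted). $T_n=n(n+1)/2$ denotes the $n$-th triangular number. Identities may be read as identities of formal power series in $q$, or for $|q|<1$. *)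

(* Defs.v *)
From mathcomp Require Import all_boot all_order all_algebra.

Set Implicit Arguments.
Unset Strict Implicit.
Unset Printing Implicit Defensive.

Import GRing.Theory.
Local Open Scope ring_scope.

(* A formal power series in q over the integers is given by its coefficients. *)
Definition fps := nat -> int.

Definition fps_mul (f g : fps) : fps :=
  fun n => \sum_(k < n.+1) f k * g (n - k)%N.

Definition triangular (n : nat) : nat := (n * n.+1) %/ 2.

(* Any quadruple with 1 <= x < y and (2 r1 + 1) x + (2 r2 + 1) y = n has all
   four entries at most n, so bounding the indices by n loses no term.  For
   n = 0 the sum is empty, so [a_coef 0 = 0]. *)
Definition a_coef (n : nat) : int :=
  \sum_(x < n.+1) \sum_(y < n.+1) \sum_(r1 < n.+1)
    \sum_(r2 < n.+1 | (1 <= x < y)%N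
                    && ((2 * r1 + 1) * x + (2 * r2 + 1) * y == n)%N)
      (-1) ^+ (r1 + r2)%N.

(* A partition of n is encoded by its multiplicities: [m i] is the number of
   occurrences of the part i + 1. *)
Definition pod (n : nat) : nat :=
  #|[set m : {ffun 'I_n -> 'I_n.+1} |
      ((\sum_(i < n) i.+1 * m i)%N == n)
      && [forall i : 'I_n, odd i.+1 ==> (m i <= 1)%N]]|.

Definition gfA : fps := a_coef.

Definition gfP : fps := fun n => (pod n)%:Z.

(* The coefficient of q^n collects the indices r >= 1 with T_(r+1) = n, all of
   which satisfy r <= n; [uphalf r] is the ceiling of r / 2. *)
Definition gfS : fps := fun n =>
  \sum_(1 <= r < n.+1 | triangular r.+1 == n)
    (-1) ^+ triangular r.-1 * (triangular (uphalf r))%:Z.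

(* Main.v *)
(* A(q) is the coefficient of c^2 in
     \prod_k (1 - c q^k + q^(2k)) / (1 + q^(2k)).
   With c = zeta + 1/zeta, Jacobi's triple product expands the numerator times
   (q;q)_oo as \sum_n (-1)^n q^(T_n) W_n(c), where W_n = \sum_(|j| <= n) zeta^j;
   the coefficient of c^2 in W_(r+1) is (-1)^(r+1) (-1)^(T_(r-1)) T_(uphalf r),
   which gives S(q).  The remaining factor 1 / \prod_k (1 - q^k) (1 + q^(2k)) is
   P(q) by Euler's identity \prod (1 + x^k) \prod (1 - x^(2k-1)) = 1 at x = q^2.
   Modulo q^(N+1) all products are finite, and the triple product follows from
   its finite form with Gaussian binomial coefficients. *)
Require Import Defs.
From mathcomp Require Import all_boot all_order all_algebra.
From mathcomp Require Import zify ring.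

Set Implicit Arguments.
Unset Strict Implicit.
Unset Printing Implicit Defensive.

Import GRing.Theory.
Local Open Scope ring_scope.

(** * Gaussian binomials and the finite triple product *)

Lemma triangularS n : triangular n.+1 = (triangular n + n.+1)%N.
Proof. rewrite /triangular; nia. Qed.

Lemma triangular_ge n : (n <= triangular n)%N.
Proof. by elim: n => // n IH; rewrite triangularS; lia. Qed.

Section GaussianBinomial.
Variables (R : comNzRingType) (q : R).

Fixpoint gauss (m k : nat) : R :=
  match m, k with
  | _, 0 => 1
  | 0, _.+1 => 0
  | m'.+1, k'.+1 => gauss m' k' + q ^+ k * gauss m' k
  end.

Lemma gauss0r m : gauss m 0 = 1. Proof. by case: m. Qed.

Lemma gaussS m k : gauss m.+1 k.+1 = gauss m k + q ^+ k.+1 * gauss m k.+1.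
Proof. by []. Qed.

Lemma gauss_small m k : (m < k)%N -> gauss m k = 0.
Proof.
elim: m k => [|m IH] [|k] //= lt_mk.
by rewrite !IH ?mulr0 ?addr0 // ltnW.
Qed.

(** The quotient of adjacent entries, with denominators cleared because [R] need not be a field. On
    or past the diagonal both sides vanish. *)
Lemma gauss_ratio m k :
  (1 - q ^+ k.+1) * gauss m k.+1 = (1 - q ^+ (m - k)) * gauss m k.
Proof.
elim: m k => [|m IH] k; first by rewrite sub0n expr0 subrr mul0r mulr0.
case: (ltnP m k) => [lt_mk | le_km].
  rewrite gauss_small ?ltnS // mulr0.
  by rewrite (_ : m.+1 - k = 0)%N ?expr0 ?subrr ?mul0r //; lia.
have -> : (1 - q ^+ k.+1) * gauss m.+1 k.+1 = (1 - q ^+ m.+1) * gauss m k.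
  have Eq : q ^+ m.+1 = q ^+ k.+1 * q ^+ (m - k) by rewrite -exprD; congr (_ ^+ _); lia.
  rewrite gaussS mulrDr mulrCA IH Eq; ring.
case: k le_km => [|k] le_km; first by rewrite !gauss0r subn0.
have Eq : q ^+ m.+1 = q ^+ k.+1 * q ^+ (m - k) by rewrite -exprD; congr (_ ^+ _); lia.
rewrite gaussS subSS mulrDr -IH Eq; ring.
Qed.

(** The difference between the two Pascal rules is exactly [gauss_ratio]. *)
Lemma gaussS' m k : gauss m.+1 k.+1 = q ^+ (m - k) * gauss m k + gauss m k.+1.
Proof.
apply/eqP; rewrite gaussS -subr_eq0; apply/eqP.
have := gauss_ratio m k; move/eqP; rewrite -subr_eq0 => /eqP H.
rewrite -oppr0 -H; ring.
Qed.

Lemma gaussSS m k : (k <= m)%N ->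
  gauss m.+2 k.+2 = (1 + q ^+ m.+1) * gauss m k.+1 + q ^+ k.+2 * gauss m k.+2
                    + q ^+ (m - k) * gauss m k.
Proof.
move=> le_km.
have Eq : q ^+ m.+1 = q ^+ k.+1 * q ^+ (m - k) by rewrite -exprD; congr (_ ^+ _); lia.
rewrite gaussS' subSS gaussS (gaussS m k.+1) Eq; ring.
Qed.

Lemma gaussSS1 m : gauss m.+2 1 = 1 + q ^+ m.+1 + q * gauss m 1.
Proof. rewrite gaussS' gaussS !gauss0r subn0 expr1; ring. Qed.

(* [W n] is the Laurent polynomial [\sum_(-n <= j <= n) zeta ^ j] expressed
   through [c = zeta + zeta^-1]. *)
Fixpoint W (c : R) (n : nat) : R :=
  match n with
  | 0 => 1
  | 1 => 1 + c
  | (n'.+1 as n1).+1 => c * W c n1 - W c n'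
  end.

Lemma WSS c n : W c n.+2 = c * W c n.+1 - W c n. Proof. by []. Qed.

(* The sign at [n = 0] comes from the convention [W_(-1) = - W_0]. *)
Definition neighbours (b : nat -> R) (n : nat) : R :=
  (if n is n'.+1 then b n' else - b 0%N) + b n.+1.

(** Reindexing of $c W_n = W_{n+1} + W_{n-1}$; the last two terms are the boundary terms of the
    truncation at [K]. *)
Lemma sum_mulc_W c (b : nat -> R) K :
  c * (\sum_(n < K.+1) b n * W c n) =
  \sum_(n < K.+1) neighbours b n * W c n + b K * W c K.+1 - b K.+1 * W c K.
Proof.
elim: K => [|K IH].
  rewrite !big_ord_recl !big_ord0 /= /neighbours; ring.
rewrite big_ord_recr mulrDr IH [in RHS]big_ord_recr /= -/(W c K.+1) /neighbours.
ring.
Qed.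

Lemma gaussnn m : gauss m m = 1.
Proof. by elim: m => // m IH; rewrite gaussS IH gauss_small // mulr0 addr0. Qed.

Lemma gauss_sym m k : (k <= m)%N -> gauss m k = gauss m (m - k).
Proof.
elim: m k => [|m IH] [|k] le_km //.
  by rewrite subn0 gauss0r gaussnn.
rewrite subSS gaussS'.
move: le_km; rewrite ltnS leq_eqVlt => /orP[/eqP-> | lt_km].
  by rewrite subnn gauss0r gaussnn (gauss_small (ltnSn m)) mulr1 addr0.
have [j Ej] : exists j, (m - k)%N = j.+1 by exists (m - k).-1; lia.
rewrite Ej gaussS (IH k) 1?ltnW // (IH k.+1) // Ej addrC.
by rewrite (_ : m - k.+1 = j)%N //; lia.
Qed.

(** Up to a signed monomial, the finite product times $1 - \zeta$ is $\prod_{|k| \le N} (1 - \zeta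
    q^k)$. The q-binomial theorem expands it along row $2N+1$; pairing opposite terms and dividing
    by $1 - \zeta$ leaves these coefficients of $W_n$. *)
Definition jcoef (N n : nat) : R :=
  if (n <= N)%N then (-1) ^+ n * q ^+ triangular n * gauss (2 * N).+1 (N - n)
  else 0.

(** This is multiplication by $1 + q^{2N+2} - c q^{N+1}$, with $c$ acting through [neighbours]. The
    three terms of [gaussSS] supply the coefficient itself and its two neighbours. *)
Lemma jcoefS N n :
  jcoef N.+1 n = (1 + q ^+ N.+1 * q ^+ N.+1) * jcoef N n
                 - q ^+ N.+1 * neighbours (jcoef N) n.
Proof.
have e2 : (2 * N.+1).+1 = (2 * N).+3 by lia.
have eqq : q ^+ (2 * N).+2 = q ^+ N.+1 * q ^+ N.+1 by rewrite -exprD; congr (_ ^+ _); lia.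
rewrite /neighbours /jcoef e2.
case: n => [|n].
  rewrite leq0n !subn0 expr0 !mul1r leq0n.
  case: N e2 eqq => [|N] e2 eqq.
    rewrite ltnn muln0 gaussSS1 gauss0r gaussnn !expr1; ring.
  rewrite ltnS leq0n subSS subn0 gaussSS; last by lia.
  have -> : ((2 * N.+1).+1 - N)%N = N.+3 by lia.
  (* The two central entries of an odd row agree; this matches the term [- b 0] of [neighbours]. *)
  have -> : gauss (2 * N.+1).+1 N.+2 = gauss (2 * N.+1).+1 N.+1.
    by rewrite gauss_sym; [congr gauss|]; lia.
  rewrite -eqq triangularS -[triangular 0]/0%N add0n !expr1 (exprS q N.+2); ring.
rewrite !triangularS.
have [lt_nN | le_Nn] := ltnP n N; last first.
  rewrite [if (_ < N)%N then _ else _]ifF ?addr0 ?mulr0 ?sub0r; last by lia.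
  rewrite ltnS; case: leqP => [le_nN | _]; last by rewrite mulr0 oppr0.
  have -> : N = n by lia.
  rewrite subSS !subnn !gauss0r exprD exprS; ring.
rewrite ltnS (ltnW lt_nN) !subSS.
have [j Ej] : exists j, N = (n + j).+1 by exists (N - n).-1; lia.
have -> : (N - n)%N = j.+1 by lia.
have -> : (N - n.+1)%N = j by lia.
case: j Ej => [|j] Ej.
  rewrite ifF ?addr0; last by lia.
  rewrite gaussSS1 gauss0r eqq Ej addn0 !exprD !exprS; ring.
rewrite ifT; last by lia.
rewrite gaussSS; last by lia.
have -> : (N - n.+2)%N = j by lia.
have -> : q ^+ ((2 * N).+1 - j) = q ^+ N.+1 * q ^+ n.+2.
  by rewrite -exprD; congr (_ ^+ _); lia.
have EN : q ^+ N.+1 = q ^+ n.+1 * q ^+ j.+2 by rewrite -exprD; congr (_ ^+ _); lia.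
rewrite eqq !EN (exprD q _ n.+2) !(exprD q (triangular n)) (exprS q n.+1) !(exprS (-1)); ring.
Qed.

(* As [N] tends to infinity this becomes Jacobi's triple product identity with
   [c = zeta + zeta^-1]. *)
Lemma finite_triple_product c N :
  \prod_(k < N) (1 + q ^+ k.+1 * q ^+ k.+1 - c * q ^+ k.+1) =
  \sum_(n < N.+1) jcoef N n * W c n.
Proof.
elim: N => [|N IH].
  by rewrite big_ord0 big_ord1 /jcoef /triangular /= !expr0 !mulr1.
have ext K : \sum_(n < N.+1) jcoef N n * W c n
           = \sum_(n < N.+1 + K) jcoef N n * W c n.
  rewrite big_split_ord /= [X in _ + X]big1 ?addr0 // => i _.
  by rewrite /jcoef ifF ?mul0r //=; apply/negbTE; rewrite -ltnNge leq_addr.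
(* One zero term is appended so that both boundary terms of [sum_mulc_W] lie outside the support of
   [jcoef N]. *)
rewrite big_ord_recr /= IH (ext 1%N) addn1.
under [in RHS]eq_bigr do rewrite jcoefS mulrBl -!mulrA.
rewrite sumrB -!mulr_sumr mulrC mulrBl; congr (_ - _).
rewrite mulrAC sum_mulc_W mulrC; congr (_ * _).
have jcoef0 n : (N < n)%N -> jcoef N n = 0 by move=> lt_Nn; rewrite /jcoef leqNgt lt_Nn.
by rewrite !jcoef0 // !mul0r subr0 addr0.
Qed.

End GaussianBinomial.

(** * Congruence of polynomials modulo a power of the variable *)

Definition eqXn (n : nat) (f g : {poly int}) := forall i, (i < n)%N -> f`_i = g`_i.

Lemma eqXn_sym n f g : eqXn n f g -> eqXn n g f.
Proof. by move=> h i lt_in; rewrite h. Qed.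

Lemma eqXn_trans n g f h : eqXn n f g -> eqXn n g h -> eqXn n f h.
Proof. by move=> h1 h2 i lt_in; rewrite h1 // h2. Qed.

Lemma eqXnW m n f g : (m <= n)%N -> eqXn n f g -> eqXn m f g.
Proof. by move=> le_mn h i lt_im; apply: h; apply: leq_trans le_mn. Qed.

Lemma eqXnD n f1 f2 g1 g2 : eqXn n f1 g1 -> eqXn n f2 g2 -> eqXn n (f1 + f2) (g1 + g2).
Proof. by move=> h1 h2 i lt_in; rewrite !coefD h1 // h2. Qed.

Lemma eqXnM n f1 f2 g1 g2 : eqXn n f1 g1 -> eqXn n f2 g2 -> eqXn n (f1 * f2) (g1 * g2).
Proof.
move=> h1 h2 i lt_in; rewrite !coefM; apply: eq_bigr => j _.
by rewrite h1 ?h2 //; have := ltn_ord j; lia.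
Qed.

Lemma eqXn_sum n I r (P : pred I) (F G : I -> {poly int}) :
  (forall i, P i -> eqXn n (F i) (G i)) ->
  eqXn n (\sum_(i <- r | P i) F i) (\sum_(i <- r | P i) G i).
Proof. by move=> h; elim/big_ind2: _ => // *; apply: eqXnD. Qed.

Lemma eqXn_prod n I r (P : pred I) (F G : I -> {poly int}) :
  (forall i, P i -> eqXn n (F i) (G i)) ->
  eqXn n (\prod_(i <- r | P i) F i) (\prod_(i <- r | P i) G i).
Proof. by move=> h; elim/big_ind2: _ => // *; apply: eqXnM. Qed.

Lemma eqXn_mulXn n m f g : eqXn n f g -> eqXn (n + m) (f * 'X^m) (g * 'X^m).
Proof. by move=> h i lt_i; rewrite !coefMXn; case: ltnP => // le_mi; apply: h; lia. Qed.

Lemma eqXn_mulXn0 n m (f : {poly int}) : (n <= m)%N -> eqXn n (f * 'X^m) 0.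
Proof. by move=> le_nm i lt_in; rewrite coefMXn coef0 ifT //; lia. Qed.

Lemma eqXn_addXn n m (f g : {poly int}) : (n <= m)%N -> eqXn n (f + g * 'X^m) f.
Proof.
by move=> le_nm; rewrite -[X in eqXn _ _ X]addr0; apply: eqXnD => //; apply: eqXn_mulXn0.
Qed.

(** Coefficient [i] of [u * f] is that of [f] plus terms in lower coefficients of [f], so strong
    induction replaces inverting [u]. *)
Lemma eqXn_cancel n (u f g : {poly int}) : u`_0 = 1 -> eqXn n (u * f) (u * g) -> eqXn n f g.
Proof.
move=> u0 h i; elim/ltn_ind: i => i IH lt_in.
have := h i lt_in; rewrite !coefM !big_ord_recl /= u0 !subn0 !mul1r.
rewrite [X in _ + X = _ -> _](_ : _ = \sum_(j < i) u`_(bump 0 j) * g`_(i - bump 0 j)); first by move/addIr.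
apply: eq_bigr => j _; rewrite IH // /bump; have := ltn_ord j; lia.
Qed.

Lemma eqXn_prod1 n m (F : 'I_m -> {poly int}) :
  (forall i, eqXn n (F i) 1) -> eqXn n (\prod_i F i) 1.
Proof.
move=> h; rewrite -[X in eqXn _ _ X](@big1_eq _ 1 *%R _ (index_enum 'I_m) predT).
by apply: eqXn_prod => i _.
Qed.

Lemma eqXn_prod_widen n (F : nat -> {poly int}) m N : (m <= N)%N ->
  (forall i, (m <= i)%N -> eqXn n (F i) 1) ->
  eqXn n (\prod_(i < N) F i) (\prod_(i < m) F i).
Proof.
move=> le_mN h; rewrite -(subnKC le_mN) big_split_ord /=.
rewrite -[X in eqXn _ _ X]mulr1; apply: eqXnM => //.
by apply: eqXn_prod1 => i; apply: h; rewrite /= leq_addr.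
Qed.

Lemma geomXn n (x : {poly int}) k m : (0 < k)%N -> (n <= m)%N ->
  eqXn n ((\sum_(r < m) (x * 'X^k) ^+ r) * (1 - x * 'X^k)) 1.
Proof.
move=> k0 le_nm; rewrite -opprB mulrN mulrC -subrX1 opprB exprMn -exprM.
rewrite -mulNr; apply: eqXn_addXn; nia.
Qed.

(** * The product formula for pod *)

Definition qfact (N : nat) : {poly int} := \prod_(k < N) (1 - 'X^(k.+1)).

Definition qplus2 (N : nat) : {poly int} := \prod_(k < N) (1 + 'X^(k.+1) * 'X^(k.+1)).

Lemma qfact_gauss m j :
  qfact j * gauss 'X m j = \prod_(i < j) (1 - 'X^(m - i)) :> {poly int}.
Proof.
elim: j => [|j IH]; first by rewrite /qfact !big_ord0 gauss0r mulr1.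
by rewrite /qfact !big_ord_recr /= -mulrA gauss_ratio mulrCA IH mulrC.
Qed.

Lemma eqXn_1subXn n m : (n <= m)%N -> eqXn n (1 - 'X^m) 1.
Proof. by move=> le_nm; rewrite -mulN1r; apply: eqXn_addXn. Qed.

Lemma qfact_widen n m : (n <= m)%N -> eqXn n.+1 (qfact m) (qfact n).
Proof.
move=> le_nm; apply: (@eqXn_prod_widen _ (fun k => 1 - 'X^(k.+1))) => // i le_ni.
by apply: eqXn_1subXn.
Qed.

Lemma qplus2_widen n m : (n <= m)%N -> eqXn n.+1 (qplus2 m) (qplus2 n).
Proof.
move=> le_nm; apply: (@eqXn_prod_widen _ (fun k => 1 + 'X^(k.+1) * 'X^(k.+1))) => // i le_ni.
by apply: eqXn_addXn.
Qed.

(** After cutting [qfact N] down to [qfact (N - m)], the remaining factors $1 - q^e$ all have $e > N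
    + m$. *)
Lemma qfact_gauss_limit N m : (m <= N)%N ->
  eqXn (N - m).+1 (qfact N * gauss 'X (2 * N).+1 (N - m)) 1.
Proof.
move=> le_mN.
apply: (@eqXn_trans _ (qfact (N - m) * gauss 'X (2 * N).+1 (N - m))).
  by apply: eqXnM => //; apply: qfact_widen; lia.
rewrite qfact_gauss; apply: eqXn_prod1 => i.
by apply: eqXn_1subXn; have := ltn_ord i; lia.
Qed.

Definition podpoly (N : nat) : {poly int} :=
  \prod_(i < N) \sum_(m < N.+1 | odd i.+1 ==> (m <= 1)%N) 'X^(i.+1 * m).

Lemma podpoly_coef N : (podpoly N)`_N = (pod N)%:Z.
Proof.
rewrite /podpoly.
under eq_bigr do rewrite big_mkcond.
rewrite bigA_distr_bigA coef_sum -natz /pod -sum1_card natr_sum [RHS]big_mkcond /=.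
apply: eq_bigr => f _; rewrite inE.
have [/forallP h | /forallPn[i hi]] := boolP [forall i : 'I_N, odd i.+1 ==> (f i <= 1)%N].
  rewrite andbT (eq_bigr (fun i : 'I_N => 'X^(i.+1 * f i))); last by move=> i _; rewrite h.
  by rewrite -expr_sum coefXn eq_sym; case: eqP.
by rewrite andbF (bigD1 i) //= (negbTE hi) mul0r coef0.
Qed.

(* Modulo [q^(N+1)], multiplying the [i]-th factor by [1 - q^i] gives [1] for
   even [i] and [1 - q^(2i)] for odd [i]. *)
Lemma podpoly_qfact N :
  eqXn N.+1 (podpoly N * qfact N)
    (\prod_(i < N) (if odd i.+1 then 1 - 'X^(i.+1) * 'X^(i.+1) else 1)).
Proof.
rewrite -big_split /=; apply: eqXn_prod => i _.
case: (odd i) => /=.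
  have := @geomXn N.+1 1 i.+1 N.+1 isT (leqnn _); rewrite mul1r => h.
  by rewrite (eq_bigr (fun m : 'I_N.+1 => 'X^(i.+1) ^+ m)) // => m _; rewrite exprM.
have -> : \sum_(m < N.+1 | (m <= 1)%N) 'X^(i.+1 * m) = 1 + 'X^(i.+1) :> {poly int}.
  case: N i => [|N] i; first by case: i.
  rewrite big_mkcond !big_ord_recl big1 /=; last by move=> j _; rewrite /bump.
  by rewrite muln0 muln1 expr0 addr0.
by rewrite (_ : (1 + _) * _ = 1 - 'X^(i.+1) * 'X^(i.+1)) //; ring.
Qed.

(* Euler's theorem on odd and distinct parts, in [q^2]. *)
Lemma euler_odd_distinct N :
  eqXn N.+1 ((\prod_(i < N) (if odd i.+1 then 1 - 'X^(i.+1) * 'X^(i.+1) else 1)) * qplus2 N) 1.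
Proof.
set O := \prod_(i < N) _.
pose x k : {poly int} := 'X^k * 'X^k.
(* Multiplying by the even-index factors completes the product to $\prod (1 - q^{4k})$. Modulo
   $q^{N+1}$ this is again [Ev], which then cancels. *)
pose Ev : {poly int} := \prod_(i < N) (if odd i.+1 then 1 else 1 - x i.+1).
pose Q m : {poly int} := \prod_(i < m) (1 - x i.+1 * x i.+1).
have OEv : O * Ev * qplus2 N = Q N.
  rewrite -!big_split; apply: eq_bigr => i _ /=; rewrite -/(x i.+1).
  by case: ifP => _; ring.
have EvQ : Ev = Q (N./2).
  rewrite /Ev; elim: N {O OEv Ev} => [|N IH]; first by rewrite /Q !big_ord0.
  rewrite big_ord_recr /= IH uphalf_half.
  case: (boolP (odd N)) => oN; rewrite /= ?mulr1 ?add0n //.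
  rewrite add1n [in RHS]/Q big_ord_recr /=; congr (_ * (1 - _)).
  by rewrite /x -!exprD; congr ('X^_); lia.
apply: (@eqXn_cancel _ Ev).
  rewrite -horner_coef0 horner_prod big1 // => i _.
  by case: ifP => _; rewrite !hornerE // expr0n mul0r subr0.
rewrite mulr1 mulrA [Ev * O]mulrC OEv EvQ.
apply: (@eqXn_prod_widen _ (fun i => 1 - x i.+1 * x i.+1)); first by lia.
by move=> i le_i; rewrite /x -!exprD; apply: eqXn_1subXn; lia.
Qed.

Lemma podpoly_inv N : eqXn N.+1 (podpoly N * qfact N * qplus2 N) 1.
Proof.
refine (eqXn_trans _ (@euler_odd_distinct N)).
by apply: eqXnM => //; apply: podpoly_qfact.
Qed.

(** Both sides invert the same series modulo $q^{n+1}$. Uniqueness of inverses avoids comparing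
    inner sums whose ranges depend on [N]. *)
Lemma podpoly_widen n N : (n <= N)%N -> eqXn n.+1 (podpoly N) (podpoly n).
Proof.
move=> le_nN.
apply: (@eqXn_trans _ (podpoly N * (podpoly n * qfact n * qplus2 n))).
  rewrite -{1}[podpoly N]mulr1; apply: eqXnM => //.
  by apply: eqXn_sym; apply: podpoly_inv.
rewrite (_ : podpoly N * _ = podpoly n * (podpoly N * qfact n * qplus2 n)); last by ring.
rewrite -[X in eqXn _ _ X]mulr1.
apply: eqXnM => //.
refine (eqXn_trans _ (eqXnW _ (@podpoly_inv N))); last by [].
apply: eqXnM; last by apply: eqXn_sym; apply: qplus2_widen.
by apply: eqXnM => //; apply: eqXn_sym; apply: qfact_widen.
Qed.

(** * The coefficient of c^2 *)

Lemma gauss_map (R S : comNzRingType) (f : {rmorphism R -> S}) q m k :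
  gauss (f q) m k = f (gauss q m k).
Proof.
elim: m k => [|m IH] [|k] //=; rewrite ?rmorph0 ?rmorph1 //.
by rewrite !IH rmorphD rmorphM rmorphXn.
Qed.

(** Applied to the embedding of polynomials in $q$ as constants in $c$, this shows that $c$ enters
    the expansion only through [W]. *)
Lemma jcoef_map (R S : comNzRingType) (f : {rmorphism R -> S}) q N n :
  jcoef (f q) N n = f (jcoef q N n).
Proof.
rewrite /jcoef; case: ifP => _; last by rewrite rmorph0.
by rewrite gauss_map !rmorphM !rmorphXn rmorphN1.
Qed.

Section CoefficientsOfW.
Variable R : comNzRingType.

(** The recurrence draws each coefficient from the one below it and links both parities, so all six
    formulas go through one induction. *)
Lemma W_coefs k :
  [/\ (W ('X : {poly R}) k.*2)`_0 = (-1) ^+ k,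
      (W ('X : {poly R}) k.*2)`_1 = - ((-1) ^+ k * k%:R) &
      (W ('X : {poly R}) k.*2)`_2 = - ((-1) ^+ k * (triangular k)%:R)] /\
  [/\ (W ('X : {poly R}) k.*2.+1)`_0 = (-1) ^+ k,
      (W ('X : {poly R}) k.*2.+1)`_1 = (-1) ^+ k * k.+1%:R &
      (W ('X : {poly R}) k.*2.+1)`_2 = - ((-1) ^+ k * (triangular k)%:R)].
Proof.
elim: k => [|k [[a0 a1 a2] [b0 b1 b2]]].
  by rewrite /= !coefE /= !mulr0 !mulr1 oppr0 !add0r !addr0.
have cS n j : (W ('X : {poly R}) n.+2)`_j.+1
    = (W ('X : {poly R}) n.+1)`_j - (W ('X : {poly R}) n)`_j.+1.
  by rewrite WSS coefB coefXM.
have c0 n : (W ('X : {poly R}) n.+2)`_0 = - (W ('X : {poly R}) n)`_0.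
  by rewrite WSS coefB coefXM sub0r.
have E0 : (W ('X : {poly R}) k.*2.+2)`_0 = (-1) ^+ k.+1 by rewrite c0 a0 exprS mulN1r.
have E1 : (W ('X : {poly R}) k.*2.+2)`_1 = - ((-1) ^+ k.+1 * k.+1%:R).
  by rewrite cS b0 a1 exprS -natr1; ring.
have E2 : (W ('X : {poly R}) k.*2.+2)`_2 = - ((-1) ^+ k.+1 * (triangular k.+1)%:R).
  by rewrite cS b1 a2 exprS triangularS natrD; ring.
rewrite doubleS; split; split=> //.
- by rewrite c0 b0 exprS mulN1r.
- by rewrite cS b1 E0 exprS -[in RHS]natr1; ring.
- by rewrite cS b2 E1 exprS triangularS natrD; ring.
Qed.

Lemma W_coef2 r :
  (-1) ^+ r.+1 * (W ('X : {poly R}) r.+1)`_2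
  = (-1) ^+ triangular r.-1 * (triangular (uphalf r))%:R.
Proof.
have sgn m n : odd m = odd n -> (-1) ^+ m = (-1) ^+ n :> R.
  by move=> h; rewrite -signr_odd h signr_odd.
have oddT m : odd (triangular m.*2) = odd m /\ odd (triangular m.*2.+1) = ~~ odd m.
  have -> : triangular m.*2 = (m * m.*2.+1)%N by rewrite /triangular; nia.
  rewrite triangularS.
  have -> : triangular m.*2 = (m * m.*2.+1)%N by rewrite /triangular; nia.
  rewrite oddD oddM /= odd_double; case: (odd m) => //.
rewrite -{1 2 3}(odd_double_half r) uphalf_half; set k := r./2.
case: (odd r); rewrite ?add0n ?add1n.
  have [[_ _ ->] _] := W_coefs k.+1.
  rewrite (sgn (triangular _) k) /=; last by case: (oddT k).
  rewrite (sgn k.*2.+2 0%N) /= ?odd_double // exprS expr0; ring.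
have [_ [_ _ ->]] := W_coefs k.
rewrite (sgn k.*2.+1 1%N) /= ?odd_double //.
rewrite (sgn (triangular _) k); first by ring.
(* For [r = 0] the truncated predecessor gives $T_0 = 0$, which has the required even parity. *)
case: k => [|k] //=; case: (oddT k) => _ ->; by [].
Qed.

End CoefficientsOfW.

(* The expansion of [q^k / (1 + q^(2k))], truncated. *)
Definition gterm (N k : nat) : {poly int} :=
  'X^k * \sum_(r < N.+1) (-1 * 'X^(k + k)) ^+ r.

Lemma gtermE N k : gterm N k = \sum_(r < N.+1) (-1) ^+ r *: 'X^((2 * r + 1) * k).
Proof.
rewrite /gterm mulr_sumr; apply: eq_bigr => r _.
rewrite exprMn mulrCA -exprM -exprD -mul_polyC polyC_exp polyCN.
by rewrite (_ : k + _ = (2 * r + 1) * k)%N //; lia.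
Qed.

Lemma gtermM N k : (0 < k)%N -> eqXn N.+1 (gterm N k * (1 + 'X^k * 'X^k)) 'X^k.
Proof.
move=> k0; rewrite /gterm -mulrA -[X in eqXn _ _ X]mulr1; apply: eqXnM => //.
rewrite -exprD -[X in 1 + X]opprK -[- 'X^_]mulN1r.
by apply: geomXn => //; lia.
Qed.

(** * Elementary symmetric functions of $q^k/(1 + q^{2k})$ *)

Definition e1 (N m : nat) : {poly int} := \sum_(x < m) gterm N x.+1.

Definition e2 (N m : nat) : {poly int} :=
  \sum_(y < m) \sum_(x < y) gterm N x.+1 * gterm N y.+1.

Lemma e2_coef N : (e2 N N)`_N = a_coef N.
Proof.
have cE x y : (gterm N x * gterm N y)`_N =
   \sum_(r1 < N.+1) \sum_(r2 < N.+1 | ((2 * r1 + 1) * x + (2 * r2 + 1) * y == N)%N)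
      (-1) ^+ (r1 + r2)%N.
  rewrite !gtermE mulr_suml coef_sum; apply: eq_bigr => r1 _.
  rewrite mulr_sumr coef_sum [RHS]big_mkcond; apply: eq_bigr => r2 _.
  rewrite -scalerAl -scalerAr scalerA -!exprD coefZ coefXn eq_sym.
  by case: eqP => _; rewrite ?mulr1 ?mulr0.
(* With [y] outermost, the indices [y = 0] and then [x = 0] contribute nothing; dropping them gives
   the shifted indices of [e2]. *)
rewrite /a_coef exchange_big big_ord_recl /= [X in _ = X + _]big1 ?add0r; last first.
  by move=> x _; rewrite !big1 // => r1 _; rewrite big_pred0 // => r2; rewrite ltn0 andbF.
rewrite coef_sum; apply: eq_bigr => y _.
rewrite big_ord_recl /= [X in _ = X + _]big1 ?add0r; last first.
  by move=> r1 _; rewrite big_pred0.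
rewrite coef_sum (big_ord_widen N (fun x => (gterm N x.+1 * gterm N y.+1)`_N)); last first.
  exact: ltnW.
rewrite big_mkcond; apply: eq_bigr => x _; rewrite cE /bump !add1n ltnS.
case: ltnP => _ //=.
by rewrite big1 // => r1 _; rewrite big_pred0.
Qed.

Definition Jprod (m : nat) : {poly {poly int}} :=
  \prod_(k < m) (1 + ('X)%:P ^+ k.+1 * ('X)%:P ^+ k.+1 - 'X * ('X)%:P ^+ k.+1).

Lemma JprodS m : Jprod m.+1 =
  Jprod m * (1 + 'X^(m.+1) * 'X^(m.+1))%:P - Jprod m * ('X^(m.+1))%:P * 'X.
Proof.
rewrite /Jprod big_ord_recr /= -!polyC_exp polyCD polyCM; ring.
Qed.

(** Dividing by [qplus2 m] turns the product into $\prod (1 - c g_k)$ with $g_k = q^k/(1 + q^{2k})$,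
    whose coefficients are signed elementary symmetric functions. *)
Lemma Jprod_coefs N m :
  [/\ (Jprod m)`_0 = qplus2 m,
      eqXn N.+1 (Jprod m)`_1 (- (qplus2 m * e1 N m)) &
      eqXn N.+1 (Jprod m)`_2 (qplus2 m * e2 N m)].
Proof.
elim: m => [|m [h0 h1 h2]].
  rewrite /Jprod /qplus2 /e1 /e2 !big_ord0 !mulr0 oppr0 !coefE; split=> //.
have q2S : qplus2 m.+1 = qplus2 m * (1 + 'X^(m.+1) * 'X^(m.+1)) by rewrite /qplus2 big_ord_recr.
set a := 1 + _ in q2S.
have gm : eqXn N.+1 'X^(m.+1) (gterm N m.+1 * a) by apply: eqXn_sym; apply: gtermM.
rewrite JprodS -/a q2S; split.
- by rewrite coefB coefMX coefMC subr0 h0.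
- rewrite coefB coefMX !coefMC /= h0 /e1 big_ord_recr /= -/(e1 N m).
  rewrite [X in eqXn _ _ X](_ : _ = - (qplus2 m * e1 N m) * a + (- qplus2 m) * (gterm N m.+1 * a)); last by ring.
  by rewrite -mulNr; apply: eqXnD; apply: eqXnM.
- rewrite coefB coefMX !coefMC /= /e2 big_ord_recr /= -/(e2 N m) -mulr_suml -/(e1 N m).
  rewrite [X in eqXn _ _ X](_ : _ = qplus2 m * e2 N m * a + qplus2 m * e1 N m * (gterm N m.+1 * a)); last by ring.
  rewrite -mulNr; apply: eqXnD; apply: eqXnM => //.
  by move=> i lt_i; rewrite coefN h1 // coefN opprK.
Qed.

(** * The series S and the factorization *)

Definition sterm (r : nat) : int := (-1) ^+ triangular r.-1 * (triangular (uphalf r))%:Z.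

Definition spoly (N : nat) : {poly int} :=
  \sum_(r < N) sterm r *: 'X^(triangular r.+1).

Lemma spoly_coef N i : (i <= N)%N -> (spoly N)`_i = gfS i.
Proof.
move=> le_iN; rewrite /gfS.
have -> : (spoly N)`_i = \sum_(r < N.+1 | triangular r.+1 == i) sterm r.
  rewrite big_mkcond big_ord_recr /= ifF; last first.
    by apply/negbTE; rewrite neq_ltn orbC (leq_trans _ (triangular_ge _)).
  rewrite addr0 coef_sum; apply: eq_bigr => r _.
  by rewrite coefZ coefXn eq_sym; case: eqP => _; rewrite ?mulr1 ?mulr0.
rewrite (big_nat_widen _ _ N.+1) // -[in LHS](big_mkord (fun r => triangular r.+1 == i) sterm).
(* The index [r = 0], present in [spoly] but not in [gfS], carries $T_0 = 0$. *)
rewrite big_ltn_cond //; have -> : sterm 0 = 0 by rewrite /sterm mulr0.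
rewrite add0r if_same; apply: eq_bigl => r.
case: eqP => //= Er; have := triangular_ge r.+1; lia.
Qed.

Lemma Jprod_spoly N : eqXn N.+1 (qfact N * (Jprod N)`_2) (spoly N).
Proof.
rewrite /Jprod finite_triple_product coef_sum big_ord_recl.
rewrite jcoef_map coefCM coef1 mulr0 add0r mulr_sumr; apply: eqXn_sum => r _.
rewrite lift0 jcoef_map coefCM /jcoef ltn_ord.
set w := _`_2.
have Ew : (-1) ^+ r.+1 * w = (sterm r)%:P.
  by rewrite W_coef2 /sterm polyCM polyC_exp polyCN -natz polyC_natr.
rewrite [X in eqXn _ X _](_ : _ = qfact N * gauss 'X (2 * N).+1 (N - r.+1) * 'X^(triangular r.+1)
                     * ((-1) ^+ r.+1 * w)); last by ring.
rewrite Ew -mul_polyC [X in eqXn _ _ X]mulrC; apply: eqXnM => //.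
rewrite -[X in eqXn _ _ X]mul1r.
(* The factor $q^{T_{r+1}}$ restores the precision lost in [qfact_gauss_limit], since $T_{r+1} \ge
   r+1$. *)
apply: (@eqXnW _ ((N - r.+1).+1 + triangular r.+1)).
  by have := triangular_ge r.+1; have := ltn_ord r; lia.
by apply: eqXn_mulXn; apply: qfact_gauss_limit.
Qed.

Theorem theorem1p3 : forall n : nat, gfA n = fps_mul gfP gfS n.
Proof.
move=> n.
have [_ _ AE] := Jprod_coefs n n.
rewrite /gfA -e2_coef.
have h : eqXn n.+1 (e2 n n) (podpoly n * spoly n).
  (* Inserting this factor, congruent to 1, exposes [qplus2 n * e2 n n], the coefficient of $c^2$ in
     [Jprod n]. *)
  apply: (@eqXn_trans _ (podpoly n * qfact n * qplus2 n * e2 n n)).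
    rewrite -{1}[e2 n n]mul1r; apply: eqXnM => //.
    by apply: eqXn_sym; apply: podpoly_inv.
  rewrite -!mulrA; apply: eqXnM => //; apply: (eqXn_trans _ (@Jprod_spoly n)).
  by apply: eqXnM => //; apply: eqXn_sym.
rewrite h // coefM; apply: eq_bigr => k _.
have le_kn : (k <= n)%N by rewrite -ltnS.
by rewrite spoly_coef ?leq_subr // (podpoly_widen le_kn) // podpoly_coef.
Qed.
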